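(* Let $p,q$ be positive integers and let $r=p/q\in\mathbb Q_{\ge 2}$. The following are equivalent: (i) The closed circle graph $E_r^{\mathrm c}$ and the open circle graph $E_r^{\mathrm o}$ are asymptotically equivalent. (ii) For all sequences of positive integers $(a_n)_n,(b_n)_n$, if $a_n/b_n\to p/q$ from below (that is, $a_n/b_n\le p/q$ for all $n$ and $a_n/b_n\to p/q$), then $E_{a_n/b_n}$ converges to $E_{p/q}$ in the asymptotic spectrum distance.
   Context: Graphs are simple and may be infinite. $E_n$ denotes the graph with $n$ vertices and no edges, $G\sqcup H$ the disjoint union, and $G\boxtimes H$ the strong product: its vertex set is $V(G)\times V(H)$, and distinct $(a,x),(b,y)$ are adjacent iff ($a=b$ or $\{a,b\}\in E(G)$) and ($x=y$ or $\{x,y\}\in E(H)$). A cohomomorphism $G\to H$ is a map $f:V(G)\to V(H)$ such that for all distinct non-adjacent $u,v\in V(G)$ the vertices $f(u),f(v)$ are distinct and non-adjacent in $H$. Write $G\le H$ if there is a cohomomorphism $G\to H$. Write $G\lesssim H$ if there is $f:\mathbb N\to\mathbb N$ with $f(n)=o(n)$ such that $G^{\boxtimes n}\le H^{\boxtimes(n+f(n))}$ for all $n\in\mathbb N$; $G,H$ are asymptotically equivalent if $G\lesssim H$ and $H\lesssim G$. The asymptotic spectrum of graphs $\mathcal X$ is the set of all maps $F$ from finite graphs to $\mathbb R_{\ge 0}$ with $F(G\sqcup H)=F(G)+F(H)$, $F(G\boxtimes H)=F(G)F(H)$, $F(E_n)=n$ for all $n\in\mathbb N$, and $G\le H\Rightarrow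 F(G)\le F(H)$. The asymptotic spectrum distance of finite graphs is $d(G,H)=\sup_{F\in\mathcal X}|F(G)-F(H)|$, and $G_i$ converges to $H$ if $d(G_i,H)\to 0$. For positive integers $p,q$ with $p/q\ge 2$, the fraction graph $E_{p/q}$ has vertex set $\{0,\dots,p-1\}$, and distinct $u,v$ are adjacent iff $u-v \bmod p<q$ or $v-u\bmod p<q$. By convention, if $p/q<2$ then $E_{p/q}$ is the complete graph on $p$ vertices. Let $C$ be a circle of unit circumference, with distance measured along the circle. For $r\in\mathbb R_{\ge2}$, $E_r^{\mathrm o}$ (resp. $E_r^{\mathrm c}$) is the graph with vertex set $C$ in which two distinct vertices are adjacent iff their distance on $C$ is strictly less than $1/r$ (resp. at most $1/r$). *)

(* Defs.v *)
(* Written for Mathematical Components and MathComp-Analysis. *)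
From HB Require Import structures.
From mathcomp Require Import all_boot all_order all_algebra.
From mathcomp Require Import all_classical all_reals all_analysis.
Set Implicit Arguments.
Unset Strict Implicit.
Unset Printing Implicit Defensive.
Import Order.TTheory GRing.Theory Num.Theory.
Import numFieldNormedType.Exports.
Local Open Scope classical_set_scope.
Local Open Scope ring_scope.

Record graph := Graph {
  vertex :> Type;
  adj : vertex -> vertex -> Prop;
  adj_sym : forall u v, adj u v -> adj v u;
  adj_irr : forall u, ~ adj u u }.

Record fin_graph := FinGraph {
  fin_graph_graph :> graph;
  fin_graph_finite : finite_set [set: vertex fin_graph_graph] }.

Definition cohomomorphism (G H : graph) (f : G -> H) : Prop :=
  forall u v : G, u <> v -> ~ adj u v -> f u <> f v /\ ~ adj (f u) (f v).

Definition cohom_le (G H : graph) : Prop :=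
  exists f : G -> H, cohomomorphism f.

Section EdgelessGraph.
Variable n : nat.

Let edgeless_adj (_ _ : 'I_n) : Prop := False.

Let edgeless_sym u v : edgeless_adj u v -> edgeless_adj v u.
Proof. by []. Qed.

Let edgeless_irr u : ~ edgeless_adj u u.
Proof. by []. Qed.

Definition edgeless : graph := Graph edgeless_sym edgeless_irr.

Lemma edgeless_finite : finite_set [set: edgeless].
Proof. exact: (@finite_finset 'I_n). Qed.

Definition fin_edgeless : fin_graph := FinGraph edgeless_finite.

End EdgelessGraph.

Section DisjointUnion.
Variables G H : graph.

Definition disjoint_union_adj (u v : G + H) : Prop :=
  match u, v with
  | inl a, inl b => adj a b
  | inr x, inr y => adj x y
  | _, _ => False
  end.

Lemma disjoint_union_sym u v :
  disjoint_union_adj u v -> disjoint_union_adj v u.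
Proof. by case: u v => [a|x] [b|y] //=; exact: adj_sym. Qed.

Lemma disjoint_union_irr u : ~ disjoint_union_adj u u.
Proof. by case: u => [a|x] /=; exact: adj_irr. Qed.

Definition disjoint_union : graph :=
  Graph disjoint_union_sym disjoint_union_irr.

End DisjointUnion.

Section StrongProduct.
Variables G H : graph.

Definition strong_product_adj (u v : G * H) : Prop :=
  [/\ u <> v, u.1 = v.1 \/ adj u.1 v.1 & u.2 = v.2 \/ adj u.2 v.2].

Lemma strong_product_sym u v :
  strong_product_adj u v -> strong_product_adj v u.
Proof.
case=> uv h1 h2; split; first by move=> vu; apply: uv.
- by case: h1 => [->|/adj_sym]; [left|right].
- by case: h2 => [->|/adj_sym]; [left|right].
Qed.

Lemma strong_product_irr u : ~ strong_product_adj u u.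
Proof. by case. Qed.

Definition strong_product : graph :=
  Graph strong_product_sym strong_product_irr.

End StrongProduct.

Lemma disjoint_union_finite (G H : fin_graph) :
  finite_set [set: disjoint_union G H].
Proof.
have -> : [set: disjoint_union G H] = (inl @` [set: G]) `|` (inr @` [set: H]).
  by apply/seteqP; split=> // -[a|x] _; [left; exists a|right; exists x].
by rewrite finite_setU; split; apply: finite_image; exact: fin_graph_finite.
Qed.

Definition fin_disjoint_union (G H : fin_graph) : fin_graph :=
  FinGraph (disjoint_union_finite G H).

Lemma strong_product_finite (G H : fin_graph) :
  finite_set [set: strong_product G H].
Proof.
have -> : [set: strong_product G H] = [set: G] `*` [set: H].
  by apply/seteqP; split.
by apply: finite_setX; exact: fin_graph_finite.
Qed.

Definition fin_strong_product (G H : fin_graph) : fin_graph :=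
  FinGraph (strong_product_finite G H).

Definition strong_power (G : graph) (n : nat) : graph :=
  iter n (strong_product G) (edgeless 1).

Definition asymp_le (R : realType) (G H : graph) : Prop :=
  exists f : nat -> nat,
    (fun n => (f n)%:R : R^o) =o_\oo (fun n => n%:R : R^o) /\
    forall n, cohom_le (strong_power G n) (strong_power H (n + f n)).

Definition asymp_equivalent (R : realType) (G H : graph) : Prop :=
  asymp_le R G H /\ asymp_le R H G.

(* A predicate rather than a [set (fin_graph -> R)], since [fin_graph] lives in
   a universe too large for the universe of [set]. *)
Definition asymptotic_spectrum (R : realType) (F : fin_graph -> R) : Prop :=
  [/\ forall G, 0 <= F G,
      forall G H, F (fin_disjoint_union G H) = F G + F H,
      forall G H, F (fin_strong_product G H) = F G * F H,
      forall n, F (fin_edgeless n) = n%:R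
    & forall G H : fin_graph, cohom_le G H -> F G <= F H].

Definition spectrum_dist (R : realType) (G H : fin_graph) : \bar R :=
  ereal_sup [set x | exists2 F : fin_graph -> R,
    asymptotic_spectrum F & x = `|F G - F H|%:E].

Definition spectrum_converges (R : realType)
    (G : nat -> fin_graph) (H : fin_graph) : Prop :=
  spectrum_dist R (G i) H @[i --> \oo] --> 0%E.

Section FractionGraph.
Variables p q : nat.

(* The first branch is the condition [2 <= p / q] cleared of denominators. *)
Definition fraction_adj (u v : 'I_p) : Prop :=
  u <> v /\
  if (2 * q <= p)%N then
    ((u%:Z - v%:Z) %% p%:Z)%Z < q%:Z \/ ((v%:Z - u%:Z) %% p%:Z)%Z < q%:Z
  else True.

Lemma fraction_sym u v : fraction_adj u v -> fraction_adj v u.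
Proof.
case=> uv h; split; first by move=> vu; apply: uv.
by move: h; case: ifP => // _ [h|h]; [right|left].
Qed.

Lemma fraction_irr u : ~ fraction_adj u u.
Proof. by case. Qed.

Lemma fraction_finite : finite_set [set: Graph fraction_sym fraction_irr].
Proof. exact: (@finite_finset 'I_p). Qed.

Definition fraction_graph : fin_graph := FinGraph fraction_finite.

End FractionGraph.

Section CircleGraphs.
Variable R : realType.

(* The circle of unit circumference is cut open at one point, so that it is
   the interval [0, 1) with the arc-length distance. *)
Definition circle : Type := {x : R | 0 <= x < 1}.

Definition circle_dist (x y : circle) : R :=
  Num.min `|val x - val y| (1 - `|val x - val y|).

Lemma circle_dist_sym x y : circle_dist x y = circle_dist y x.
Proof. by rewrite /circle_dist distrC. Qed.

Variable r : R.

Definition open_circle_adj (x y : circle) : Prop :=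
  x <> y /\ circle_dist x y < 1 / r.

Lemma open_circle_sym x y : open_circle_adj x y -> open_circle_adj y x.
Proof. by case=> xy h; split; [move=> yx; apply: xy|rewrite circle_dist_sym]. Qed.

Lemma open_circle_irr x : ~ open_circle_adj x x.
Proof. by case. Qed.

Definition open_circle_graph : graph := Graph open_circle_sym open_circle_irr.

Definition closed_circle_adj (x y : circle) : Prop :=
  x <> y /\ circle_dist x y <= 1 / r.

Lemma closed_circle_sym x y : closed_circle_adj x y -> closed_circle_adj y x.
Proof. by case=> xy h; split; [move=> yx; apply: xy|rewrite circle_dist_sym]. Qed.

Lemma closed_circle_irr x : ~ closed_circle_adj x x.
Proof. by case. Qed.

Definition closed_circle_graph : graph :=
  Graph closed_circle_sym closed_circle_irr.

End CircleGraphs.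

(* Main.v *)
Require Import Defs.
From HB Require Import structures.
From mathcomp Require Import all_boot all_order all_algebra.
From mathcomp Require Import all_classical all_reals all_analysis.
From mathcomp Require Import ring lra zify.
Set Implicit Arguments.
Unset Strict Implicit.
Unset Printing Implicit Defensive.
Import Order.TTheory GRing.Theory Num.Theory.
Import numFieldNormedType.Exports.
Local Open Scope classical_set_scope.
Local Open Scope ring_scope.

(** Write [E_x] for the fraction graph of [x = a / b], and order graphs by
    cohomomorphisms.  For [r = p / q >= 2] the open circle graph of parameter
    [r] is equivalent to [E_r]: place the vertices of [E_r] at the multiples of
    [1 / p] ([fraction_le_open]), or round a point of the circle down to such a
    multiple ([open_le_fraction]).  The closed circle graph behaves like the
    limit of the graphs [E_x] for [x < r].  It lies above all of them, and a
    finite graph below one of its powers lies below the same power of [E_x] for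
    all [x < r] close to [r], because only finitely many distances occur and
    those greater than [1 / r] are greater than some [1 / s] with [s < r]
    ([finite_le_closed_near_left]).  As the closed circle graph is trivially
    below the open one, asymptotic equivalence amounts to
    [E_r ^ n <= (closed circle graph) ^ (n + o(n))].

    Suppose this holds.  Then [E_r ^ n <= E_x ^ (n + o(n))] for all [x <= r] close
    to [r], how close depending on [n].  Applying a point [F] of the spectrum
    gives [F(E_r) ^ n <= F(E_x) ^ (n + o(n))].  Since [1 <= F(E_x) <= p], taking
    [n]-th roots bounds [F(E_r) - F(E_x)] uniformly in [F]
    ([asymp_le_fraction_converges]).

    Conversely, let [E_x] converge to [E_r] and fix [m].  For some [x < r] all [F]
    satisfy [F(E_r) ^ m < 3 F(E_x) ^ m].  Strassen duality ([strassen_duality])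
    turns this comparison of spectral values into cohomomorphisms
    [E_r ^ (m n) <= K * 6 ^ n * E_x ^ (m n)] for all [n], with [K] independent of
    [n].  Constants are absorbed by powers of [E_x], which is above [E_2] and
    hence above two isolated vertices, so that
    [E_r ^ (m n) <= E_x ^ ((m + 3) n + k)].  Since [m] is arbitrary, the required
    exponents are [n + o(n)] ([fraction_converges_asymp_le]).

    Duality is proved for a preorder on an abstract commutative semiring.  If [a]
    is not asymptotically below [b], then [b <= a] can be added to the preorder
    without collapsing the order of the natural numbers; Zorn's lemma extends
    the result to a total preorder, and a total preorder defines a real-valued
    homomorphism by Dedekind cuts.  The preorder itself being nontrivial, this
    also shows that the asymptotic spectrum is nonempty, so that the supremum
    defining the distance is never [-oo]. *)

(** * Strassen duality for preordered semirings *)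

Record semiring_preorder (S : comNzSemiRingType) (Q : S -> S -> Prop) : Prop :=
  SemiringPreorder {
    spo_refl : forall a, Q a a;
    spo_trans : forall b a c, Q a b -> Q b c -> Q a c;
    spo_addr : forall c a b, Q a b -> Q (a + c) (b + c);
    spo_mulr : forall c a b, Q a b -> Q (a * c) (b * c) }.

Definition nontrivial (S : comNzSemiRingType) (Q : S -> S -> Prop) : Prop :=
  forall n, ~ Q n.+1%:R n%:R.

Record strassen_preorder (S : comNzSemiRingType) (Q : S -> S -> Prop) : Prop :=
  StrassenPreorder {
    strassen_spo :> semiring_preorder Q;
    strassen_nontrivial : nontrivial Q;
    strassen_ge0 : forall a, Q 0 a;
    strassen_ge1 : forall a, a = 0 \/ Q 1 a;
    strassen_bounded : forall a, exists n : nat, Q a n%:R }.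

Record spectral_point (R : realType) (S : comNzSemiRingType)
    (Q : S -> S -> Prop) (F : S -> R) : Prop := SpectralPoint {
  spectralD : forall a b, F (a + b) = F a + F b;
  spectralM : forall a b, F (a * b) = F a * F b;
  spectral_nat : forall n, F n%:R = n%:R;
  spectral_le : forall a b, Q a b -> F a <= F b }.

Section SemiringPreorder.
Variables (S : comNzSemiRingType) (Q : S -> S -> Prop).
Hypothesis Qspo : semiring_preorder Q.

Lemma spoD a b c d : Q a b -> Q c d -> Q (a + c) (b + d).
Proof.
move=> ab cd; apply: (spo_trans Qspo (spo_addr Qspo _ ab)).
by rewrite ![b + _]addrC; exact: (spo_addr Qspo).
Qed.

Lemma spoM a b c d : Q a b -> Q c d -> Q (a * c) (b * d).
Proof.
move=> ab cd; apply: (spo_trans Qspo (spo_mulr Qspo _ ab)).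
by rewrite ![b * _]mulrC; exact: (spo_mulr Qspo).
Qed.

Lemma spoX a b n : Q a b -> Q (a ^+ n) (b ^+ n).
Proof.
move=> ab; elim: n => [|n IHn]; first exact: spo_refl.
by rewrite !exprS; exact: spoM.
Qed.

Lemma spo_iterD x a b n : Q (x + a) (x + b) -> Q (x + n%:R * a) (x + n%:R * b).
Proof.
move=> xab; elim: n => [|n IHn]; first by rewrite !mul0r; exact: spo_refl.
have -> : x + n.+1%:R * a = (x + n%:R * a) + a by ring.
have -> : x + n.+1%:R * b = (x + b) + n%:R * b by ring.
apply: (spo_trans Qspo (spo_addr Qspo a IHn)).
have -> : x + n%:R * b + a = (x + a) + n%:R * b by ring.
exact: spo_addr.
Qed.

Lemma spo_iterM c a b n : Q (c * a) (c * b) -> Q (c * a ^+ n) (c * b ^+ n).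
Proof.
move=> cab; elim: n => [|n IHn]; first exact: spo_refl.
have -> : c * a ^+ n.+1 = (c * a) * a ^+ n by rewrite exprS mulrA.
have -> : c * b ^+ n.+1 = (c * b ^+ n) * b by rewrite exprSr mulrA.
apply: (spo_trans Qspo (spo_mulr Qspo _ cab)).
have -> : c * b * a ^+ n = (c * a ^+ n) * b by rewrite mulrAC.
exact: spo_mulr.
Qed.

(** The semiring preorder generated by [Q] and [a <= b].  Only multiples of the
    difference [b - a] by elements of the semiring have to be adjoined, since
    a semiring preorder need not be closed under products of differences. *)
Definition adjoin_le (a b s t : S) : Prop :=
  exists c, Q (s + c * b) (t + c * a).

Lemma adjoin_le_sub a b s t : Q s t -> adjoin_le a b s t.
Proof. by move=> st; exists 0; rewrite !mul0r; exact: spo_addr. Qed.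

Lemma adjoin_le_pair a b : adjoin_le a b a b.
Proof. by exists 1; rewrite !mul1r addrC; exact: spo_refl. Qed.

Lemma adjoin_le_spo a b : semiring_preorder (adjoin_le a b).
Proof.
split=> [s|t s u [c st] [d tu]|d s t [c st]|d s t [c st]].
- by apply: adjoin_le_sub; exact: (spo_refl Qspo).
- exists (c + d).
  have -> : s + (c + d) * b = (s + c * b) + d * b by ring.
  apply: (spo_trans Qspo (spo_addr Qspo _ st)).
  have -> : t + c * a + d * b = (t + d * b) + c * a by ring.
  have -> : u + (c + d) * a = (u + d * a) + c * a by ring.
  exact: (spo_addr Qspo).
- exists c; rewrite ![_ + d + _]addrAC; exact: (spo_addr Qspo).
- exists (c * d).
  have -> : s * d + c * d * b = (s + c * b) * d by ring.
  have -> : t * d + c * d * a = (t + c * a) * d by ring.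
  exact: (spo_mulr Qspo).
Qed.

End SemiringPreorder.

Section StrassenPreorder.
Variables (S : comNzSemiRingType) (Q : S -> S -> Prop).
Hypothesis QS : strassen_preorder Q.

Lemma strassen_natW m n : (m <= n)%N -> Q m%:R n%:R.
Proof.
move=> /subnK <-; rewrite natrD -[X in Q X _]add0r.
exact: (spo_addr QS _ (strassen_ge0 QS _)).
Qed.

Lemma strassen_nat_le m n : Q m%:R n%:R -> (m <= n)%N.
Proof.
move=> mn; rewrite leqNgt; apply/negP => nm; apply: (strassen_nontrivial QS (n:=n)).
exact: (spo_trans QS (strassen_natW nm)).
Qed.

(** If [u] were at least [1], then iterating would put every [n + x] below [x],
    and [x] is below some natural number. *)
Lemma strassen_absorb u x : Q (u + x) x -> u = 0.
Proof.
move=> ux; case: (strassen_ge1 QS u) => // u1; exfalso.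
have [K xK] := strassen_bounded QS x.
have Nx n : Q (n%:R + x) x.
  elim: n => [|n IHn]; first by rewrite add0r; exact: (spo_refl QS).
  have -> : n.+1%:R + x = 1 + (n%:R + x) by ring.
  apply: (spo_trans QS _ ux); exact: (spoD QS u1 IHn).
apply: (strassen_nontrivial QS (n:=K)); apply: (spo_trans QS _ xK).
apply: (spo_trans QS _ (Nx K.+1)); rewrite -[X in Q X _]addr0.
by apply: (spoD QS (spo_refl QS _)); exact: (strassen_ge0 QS).
Qed.

(** Positivity and boundedness are inherited by larger relations, so along the
    extensions below only nontriviality has to be controlled. *)
Lemma strassen_sup (Q' : S -> S -> Prop) :
  semiring_preorder Q' -> nontrivial Q' -> (forall a b, Q a b -> Q' a b) ->
  strassen_preorder Q'.
Proof.
move=> Q'spo Q'nt QQ'; split=> // [a|a|a].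
- exact/QQ'/(strassen_ge0 QS).
- by case: (strassen_ge1 QS a) => [|/QQ']; [left|right].
- by have [n /QQ' an] := strassen_bounded QS a; exists n.
Qed.

(** The obstructions to adjoining [a <= b] and to adjoining [b <= a] cancel: if
    [n + 1 + c b <= n + c a] and [m + 1 + d a <= m + d b], then [d] times the
    first plus [c] times the second gives [(c + d) + x <= x]. *)
Lemma adjoin_le_nontrivial a b :
  nontrivial (adjoin_le Q a b) \/ nontrivial (adjoin_le Q b a).
Proof.
apply: contrapT => /not_orP[/existsNP[n /contrapT[c nc]]].
move=> /existsNP[m /contrapT[d md]].
have cd0 : c + d = 0.
  apply: (@strassen_absorb _ (n%:R * d + m%:R * c + c * d * a + c * d * b)).
  have -> : c + d + (n%:R * d + m%:R * c + c * d * a + c * d * b) =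
    (n.+1%:R + c * b) * d + (m.+1%:R + d * a) * c by ring.
  have -> : n%:R * d + m%:R * c + c * d * a + c * d * b =
    (n%:R + c * a) * d + (m%:R + d * b) * c by ring.
  by apply: (spoD QS); exact: (spo_mulr QS).
have c0 : c = 0.
  apply: (@strassen_absorb _ 0); rewrite addr0 -[X in Q _ X]cd0.
  rewrite -[X in Q X _]addr0; apply: (spoD QS (spo_refl QS _)).
  exact: (strassen_ge0 QS).
apply: (strassen_nontrivial QS (n:=n)).
by move: nc; rewrite c0 !mul0r !addr0.
Qed.

End StrassenPreorder.

(** A maximal nontrivial extension is total by [adjoin_le_nontrivial]: for any
    [a] and [b] one of the two inequalities can be adjoined, so by maximality it
    already holds. *)
Lemma exists_total_strassen (S : comNzSemiRingType) (P : S -> S -> Prop) :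
  strassen_preorder P ->
  exists Q, [/\ strassen_preorder Q, forall a b, P a b -> Q a b
    & forall a b, Q a b \/ Q b a].
Proof.
move=> PS.
(* The union of an empty chain is empty, hence not a preorder: the candidates
   are arbitrary sets of pairs, to which [P] is added. *)
pose ext (X : set (S * S)) := fun a b => X (a, b) \/ P a b.
pose good (X : set (S * S)) := semiring_preorder (ext X) /\ nontrivial (ext X).
have [F Fgood Ftot|X [[Xspo Xnt] Xmax]] := @Zorn_bigcup (S * S)%type good.
  have [[A FA]|F0] := pselect (exists A, F A); last first.
    have -> : \bigcup_(X in F) X = set0.
      by apply/seteqP; split=> // z [A FA _]; case: F0; exists A.
    have ext0 : ext set0 = P.
      apply/funext => a; apply/funext => b; apply/propext.
      by split=> [[]|]; [| |right].
    rewrite /good ext0.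
    by split; [exact: PS|exact: (strassen_nontrivial PS)].
  have up B a b : F B -> ext B a b -> ext (\bigcup_(X in F) X) a b.
    by move=> FB [Bab|]; [left; exists B|right].
  have down a b : ext (\bigcup_(X in F) X) a b -> exists2 B, F B & ext B a b.
    by case=> [[B FB Bab]|Pab]; [exists B => //; left|exists A => //; right].
  have join B C : F B -> F C -> exists D,
      [/\ F D, forall a b, ext B a b -> ext D a b
        & forall a b, ext C a b -> ext D a b].
    move=> FB FC; case: (Ftot _ _ FB FC) => sub.
    - by exists C; split=> // a b [/sub|]; [left|right].
    - by exists B; split=> // a b [/sub|]; [left|right].
  split; last first.
    by move=> n /down[B /Fgood[_ Bnt]]; exact: Bnt.
  split=> [a|b a c|c a b|c a b].
  - by apply: (up _ _ _ FA); exact: (spo_refl (Fgood _ FA).1).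
  - move=> /down[B FB ab] /down[C FC bc]; have [D [FD BD CD]] := join _ _ FB FC.
    apply: (up _ _ _ FD).
    by apply: (spo_trans (Fgood _ FD).1); [exact: BD ab|exact: CD].
  - move=> /down[B FB ab]; apply: (up _ _ _ FB).
    exact: (spo_addr (Fgood _ FB).1).
  - move=> /down[B FB ab]; apply: (up _ _ _ FB).
    exact: (spo_mulr (Fgood _ FB).1).
have QS : strassen_preorder (ext X).
  by apply: (strassen_sup PS) => // a b; right.
exists (ext X); split=> // [a b|]; first by right.
have add a b : nontrivial (adjoin_le (ext X) a b) -> ext X a b.
  move=> nt; apply: contrapT => nab.
  pose Y := [set z : S * S | adjoin_le (ext X) a b z.1 z.2].
  have extY : ext Y = adjoin_le (ext X) a b.
    apply/funext => s; apply/funext => t; apply/propext; split=> [[//|Pst]|].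
      by apply: (adjoin_le_sub Xspo); right.
    by left.
  apply: (Xmax Y); last by rewrite /good extY; split=> //; exact: adjoin_le_spo.
  split=> [[s t] Xst|Yle]; first by apply: (adjoin_le_sub Xspo); left.
  by apply: nab; left; apply: (Yle (a, b)); exact: adjoin_le_pair.
by move=> a b; case: (adjoin_le_nontrivial QS a b) => /add; [left|right].
Qed.

(** The form in which approximations [n x = n y + O(1)] are used below. *)
Lemma eq_by_archimedean (R : realType) (x y K : R) :
  (forall n : nat, (0 < n)%N -> n%:R * `|x - y| <= K) -> x = y.
Proof.
move=> xyK; apply/eqP; rewrite -subr_eq0 -normr_eq0; apply/negP => /negP xy0.
have d0 : 0 < `|x - y| by rewrite lt_neqAle eq_sym xy0 normr_ge0.
have K0 : 0 <= K by apply: le_trans (xyK 1%N _); rewrite ?mul1r.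
have := xyK (Num.truncn (K / `|x - y|)).+1 isT; apply/negP; rewrite -ltNge.
by rewrite -ltr_pdivrMr // truncnS_gt.
Qed.

Section TotalSpectralPoint.
Variables (R : realType) (S : comNzSemiRingType) (Q : S -> S -> Prop).
Hypothesis QS : strassen_preorder Q.
Hypothesis Qtot : forall a b, Q a b \/ Q b a.

Let cut (a : S) : set R := [set x | exists s r : nat,
  [/\ (0 < s)%N, Q (s%:R * a) r%:R & x = r%:R / s%:R]].

Let F (a : S) : R := inf (cut a).

Let floor a s : exists r : nat, Q r%:R (s%:R * a) /\ Q (s%:R * a) r.+1%:R.
Proof.
have [k] := strassen_bounded QS (s%:R * a); elim: k => [|k IHk] sak.
  exists 0%N; split; first exact: (strassen_ge0 QS).
  by apply: (spo_trans QS sak); exact: (strassen_ge0 QS).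
by case: (Qtot (s%:R * a) k%:R) => [/IHk|kas] //; exists k.
Qed.

Let cut_ge a s r x : (0 < s)%N -> Q r%:R (s%:R * a) -> cut a x -> r%:R / s%:R <= x.
Proof.
move=> s0 rsa [s' [r' [s'0 sar' ->]]].
rewrite ler_pdivrMr ?ltr0n // mulrAC ler_pdivlMr ?ltr0n // -!natrM ler_nat.
apply: (strassen_nat_le QS); rewrite !natrM.
have := spo_mulr QS s'%:R rsa; move=> /(spo_trans QS); apply.
have -> : s%:R * a * s'%:R = s'%:R * a * s%:R by ring.
exact: (spo_mulr QS).
Qed.

Let cut0 a : cut a !=set0.
Proof.
have [n an] := strassen_bounded QS a.
by exists (n%:R / 1%:R), 1%N, n; rewrite mul1r.
Qed.

Let F_ge a s r : (0 < s)%N -> Q r%:R (s%:R * a) -> r%:R <= s%:R * F a.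
Proof.
move=> s0 rsa; rewrite mulrC -ler_pdivrMr ?ltr0n //; apply: lb_le_inf => //.
by move=> x; exact: cut_ge.
Qed.

Let F_le a s r : (0 < s)%N -> Q (s%:R * a) r%:R -> s%:R * F a <= r%:R.
Proof.
move=> s0 sar; rewrite mulrC -ler_pdivlMr ?ltr0n //; apply: ge_inf; last first.
  by exists s, r.
exists (0%:R / 1%:R) => x; apply: cut_ge => //; exact: (strassen_ge0 QS).
Qed.

Let approx a s : (0 < s)%N -> exists r : nat,
  [/\ Q r%:R (s%:R * a), Q (s%:R * a) r.+1%:R, r%:R <= s%:R * F a
    & s%:R * F a <= r%:R + 1].
Proof.
move=> s0; have [r [ra ar]] := floor a s; exists r; split=> //.
- exact: F_ge.
- by rewrite natr1; exact: F_le.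
Qed.

(** Totality gives, for each [s > 0], some [r] with [r <= s a <= r + 1].  These
    inequalities can be added and multiplied, so [s F(a)] is known up to a
    bounded error when [a] is a sum, and [s ^ 2 F(a)] up to an error linear in
    [s] when [a] is a product; letting [s] grow gives the identities. *)
Lemma total_spectral_point : exists F : S -> R, spectral_point Q F.
Proof.
exists F; split.
- move=> a b; apply: (@eq_by_archimedean _ _ _ 2) => s s0.
  have [x [xa ax lx ux]] := approx a s0.
  have [y [yb bY ly uy]] := approx b s0.
  have l : (x + y)%:R <= s%:R * F (a + b).
    by apply: F_ge => //; rewrite natrD mulrDr; exact: (spoD QS).
  have u : s%:R * F (a + b) <= (x.+1 + y.+1)%:R.
    by apply: F_le => //; rewrite natrD mulrDr; exact: (spoD QS).
  rewrite -[s%:R]ger0_norm // -normrM ler_norml.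
  move: l u; rewrite !natrD -!natr1 => l u; apply/andP; split; lra.
- move=> a b; apply: (@eq_by_archimedean _ _ _ (F a + F b + 1)) => s s0.
  have [x [xa ax lx ux]] := approx a s0.
  have [y [yb bY ly uy]] := approx b s0.
  have ss0 : (0 < s * s)%N by rewrite muln_gt0 s0.
  have Ess : (s * s)%:R * (a * b) = (s%:R * a) * (s%:R * b) by ring.
  have l : (x * y)%:R <= (s * s)%:R * F (a * b).
    by apply: F_ge => //; rewrite Ess natrM; exact: (spoM QS).
  have u : (s * s)%:R * F (a * b) <= (x.+1 * y.+1)%:R.
    by apply: F_le => //; rewrite Ess natrM; exact: (spoM QS).
  have s1 : 1 <= s%:R :> R by rewrite ler1n.
  rewrite -(@ler_pM2l _ s%:R) ?ltr0n // mulrA -natrM -[(s * s)%:R]ger0_norm //.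
  rewrite -normrM ler_norml.
  move: l u; rewrite !natrM -!natr1 => l u.
  have x0 : 0 <= x%:R :> R by []. have y0 : 0 <= y%:R :> R by [].
  have l2 : x%:R * y%:R <= (s%:R * F a) * (s%:R * F b) by apply: ler_pM.
  have u2 : (s%:R * F a) * (s%:R * F b) <= (x%:R + 1) * (y%:R + 1).
    by apply: ler_pM => //; [exact: le_trans lx|exact: le_trans ly].
  apply/andP; split; lra.
- move=> n; have E : 1%:R * n%:R = n%:R :> S by rewrite mul1r.
  have l : n%:R <= 1%:R * F n%:R by apply: F_ge; rewrite // E; exact: (spo_refl QS).
  have u : 1%:R * F n%:R <= n%:R by apply: F_le; rewrite // E; exact: (spo_refl QS).
  by apply/eqP; rewrite eq_le -[F _]mul1r u l.
- move=> a b ab; rewrite leNgt; apply/negP => ba.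
  suff E : F a = F b by rewrite E ltxx in ba.
  apply: (@eq_by_archimedean _ _ _ 1) => s s0.
  have [x [xa ax lx ux]] := approx a s0.
  have : x%:R <= s%:R * F b.
    apply: F_ge => //; apply: (spo_trans QS xa).
    by rewrite ![s%:R * _]mulrC; exact: (spo_mulr QS).
  rewrite gtr0_norm ?subr_gt0 //; lra.
Qed.

End TotalSpectralPoint.

Lemma spectral_point_exists (R : realType) (S : comNzSemiRingType)
    (P : S -> S -> Prop) :
  strassen_preorder P -> exists F : S -> R, spectral_point P F.
Proof.
move=> /exists_total_strassen[Q [QS PQ Qtot]].
have [F [FD FM Fn Fle]] := total_spectral_point R QS Qtot.
by exists F; split=> // a b /PQ; exact: Fle.
Qed.

(** Adjoining [b <= a] must collapse, since otherwise the extension has a spectral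
    point, which contradicts [F a < F b].  The collapse reads
    [n + 1 + c a <= n + c b] with [c >= 1].  The summand [n] cannot be cancelled;
    adding [n + 1] copies and estimating it by [(n + 1) c b] costs the factor
    [2].  The factor [c' = (n + 1) c] is then kept outside the powers,
    [c' a ^ N <= c' (2 b) ^ N], so that it only contributes the constant [K]. *)
Lemma strassen_duality (R : realType) (S : comNzSemiRingType)
    (P : S -> S -> Prop) (a b : S) :
  strassen_preorder P -> P 1 b ->
  (forall F : S -> R, spectral_point P F -> F a < F b) ->
  exists K : nat, forall n, P (a ^+ n) (K%:R * (2 * b) ^+ n).
Proof.
move=> PS b1 ab.
have : ~ nontrivial (adjoin_le P b a).
  move=> nt; have QS : strassen_preorder (adjoin_le P b a).
    apply: (strassen_sup PS) => //; first exact: (adjoin_le_spo PS).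
    by move=> s t; exact: (adjoin_le_sub PS).
  have [F [FD FM Fn Fle]] := spectral_point_exists R QS.
  have : F a < F b.
    by apply: ab; split=> // s t st; apply/Fle/(adjoin_le_sub PS).
  by apply/negP; rewrite -leNgt; apply/Fle/(adjoin_le_pair PS).
move=> /existsNP[n /contrapT[c nc]].
have c1 : P 1 c.
  case: (strassen_ge1 PS c) => // c0; exfalso.
  by apply: (strassen_nontrivial PS (n:=n)); move: nc; rewrite c0 !mul0r !addr0.
have nc' : P (n.+1%:R + c * a) (n.+1%:R + c * b).
  apply: (spo_trans PS nc); apply: (spo_addr PS); exact: strassen_natW.
have n1c : P n.+1%:R (n.+1%:R * c).
  by rewrite -[X in P X _]mulr1; apply: (spoM PS) => //; exact: (spo_refl PS).
have cab : P (n.+1%:R * c * a) (n.+1%:R * c * (2 * b)).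
  rewrite -mulrA -[X in P X _]add0r.
  apply: (spo_trans PS (spo_addr PS _ (strassen_ge0 PS n.+1%:R))).
  apply: (spo_trans PS (spo_iterD PS n.+1 nc')).
  have -> : n.+1%:R * c * (2 * b) = n.+1%:R * c * b + n.+1%:R * c * b by ring.
  rewrite [n.+1%:R * (c * b)]mulrA; apply: (spo_addr PS).
  by rewrite -[X in P X _]mulr1; exact: (spoM PS).
have [K cK] := strassen_bounded PS (n.+1%:R * c).
exists K => N; apply: (spo_trans PS _ (spo_mulr PS _ cK)).
apply: (spo_trans PS _ (spo_iterM PS N cab)).
rewrite -[X in P X _]mul1r; apply: (spo_mulr PS).
by apply: (spo_trans PS _ n1c); exact: (strassen_natW PS (m:=1)).
Qed.

(** * The semiring of finite graphs *)

Definition ord0_elim (T : Type) (i : 'I_0) : T :=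
  False_rect T (notF (ltn_ord i)).

(** Adjacency in the complement graph: cohomomorphisms are exactly the maps that
    preserve it, and in a strong product it is a disjunction over the
    coordinates. *)
Definition far (G : graph) (u v : G) : Prop := u <> v /\ ~ adj u v.

Lemma far_sym (G : graph) (u v : G) : far u v -> far v u.
Proof. by case=> uv nuv; split=> [/esym//|/adj_sym]. Qed.

Lemma cohom_leP (G H : graph) :
  cohom_le G H <-> exists f : G -> H, forall u v, far u v -> far (f u) (f v).
Proof.
split=> -[f fP]; exists f; first by move=> u v [uv nuv]; exact: fP.
by move=> u v uv nuv; exact: fP.
Qed.

Lemma far_product (G H : graph) (u v : strong_product G H) :
  far u v <-> far u.1 v.1 \/ far u.2 v.2.
Proof.
case: u v => [a x] [b y]; rewrite /far /=; split=> [[uv nuv]|[[ab nab]|[xy nxy]]].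
- have [[ab|ab]|ab] := pselect (a = b \/ adj a b); last first.
  + by left; split=> E; apply: ab; [left|right].
  + by right; split=> E; apply: nuv; split=> //=; auto.
  + right; split=> E; first by apply: uv; rewrite ab E.
    by apply: nuv; split=> //=; [left|right].
- by split; [case|case=> _ []].
- by split; [case|case=> _ _ []].
Qed.

Lemma cohom_le_refl (G : graph) : cohom_le G G.
Proof. by apply/cohom_leP; exists id. Qed.

Lemma cohom_le_trans (H G K : graph) : cohom_le G H -> cohom_le H K -> cohom_le G K.
Proof.
move=> /cohom_leP[f fP] /cohom_leP[g gP]; apply/cohom_leP; exists (g \o f).
by move=> u v /fP/gP.
Qed.

Lemma cohom_le_product (G H G' H' : graph) : cohom_le G G' -> cohom_le H H' ->
  cohom_le (strong_product G H) (strong_product G' H').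
Proof.
move=> /cohom_leP[f fP] /cohom_leP[g gP]; apply/cohom_leP.
exists (fun u => (f u.1, g u.2)) => u v /far_product[/fP|/gP] uv.
- by apply/far_product; left.
- by apply/far_product; right.
Qed.

Lemma far_inl (G H : graph) (a b : G) :
  far a b -> far (inl a : disjoint_union G H) (inl b).
Proof. by case=> ab nab; split=> // -[]. Qed.

Lemma far_inr (G H : graph) (x y : H) :
  far x y -> far (inr x : disjoint_union G H) (inr y).
Proof. by case=> xy nxy; split=> // -[]. Qed.

Lemma far_inl_inr (G H : graph) (a : G) (x : H) :
  far (inl a : disjoint_union G H) (inr x).
Proof. by split. Qed.

Lemma far_inr_inl (G H : graph) (a : G) (x : H) :
  far (inr x : disjoint_union G H) (inl a).
Proof. by split. Qed.

#[local] Hint Resolve far_inl_inr far_inr_inl : core.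

Lemma inl_far (G H : graph) (a b : G) :
  far (inl a : disjoint_union G H) (inl b) -> far a b.
Proof. by case=> ab nab; split=> // E; apply: ab; rewrite E. Qed.

Lemma inr_far (G H : graph) (x y : H) :
  far (inr x : disjoint_union G H) (inr y) -> far x y.
Proof. by case=> xy nxy; split=> // E; apply: xy; rewrite E. Qed.

Lemma far_edgeless n (i j : edgeless n) : far i j <-> i <> j.
Proof. by split=> [[]//|ij]; split. Qed.

Lemma cohom_le_union (G H G' H' : graph) : cohom_le G G' -> cohom_le H H' ->
  cohom_le (disjoint_union G H) (disjoint_union G' H').
Proof.
move=> /cohom_leP[f fP] /cohom_leP[g gP]; apply/cohom_leP.
exists (fun u => match u with inl a => inl (f a) | inr x => inr (g x) end).
move=> [a|x] [b|y] uv //.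
- by apply/far_inl/fP; exact: inl_far uv.
- by apply/far_inr/gP; exact: inr_far uv.
Qed.

Lemma cohom_le_edgeless (G : graph) n (f : G -> 'I_n) :
  injective f -> cohom_le G (edgeless n).
Proof.
move=> f_inj; apply/cohom_leP; exists f => u v [uv _].
by apply/far_edgeless => /f_inj.
Qed.

Lemma edgeless_cohom_le (G : graph) n (f : 'I_n -> G) :
  (forall i j, i <> j -> far (f i) (f j)) -> cohom_le (edgeless n) G.
Proof. by move=> fP; apply/cohom_leP; exists f => i j /far_edgeless/fP. Qed.

Lemma edgeless1_le (G : graph) (x : G) : cohom_le (edgeless 1) G.
Proof. by apply: (@edgeless_cohom_le _ _ (fun=> x)) => i j; rewrite !ord1. Qed.

Lemma edgeless0_le (G : graph) : cohom_le (edgeless 0) G.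
Proof. by apply: (@edgeless_cohom_le _ _ (@ord0_elim G)) => -[]. Qed.

Definition cohom_equiv (G H : graph) : Prop := cohom_le G H /\ cohom_le H G.

Lemma cohom_equiv_sym (G H : graph) : cohom_equiv G H -> cohom_equiv H G.
Proof. by case. Qed.

Lemma cohom_equiv_trans (H G K : graph) :
  cohom_equiv G H -> cohom_equiv H K -> cohom_equiv G K.
Proof.
move=> [GH HG] [HK KH]; split; first exact: cohom_le_trans HK.
exact: cohom_le_trans HG.
Qed.

Lemma cohom_equiv_union (G H G' H' : graph) : cohom_equiv G G' -> cohom_equiv H H' ->
  cohom_equiv (disjoint_union G H) (disjoint_union G' H').
Proof. by move=> [? ?] [? ?]; split; exact: cohom_le_union. Qed.

Lemma cohom_equiv_product (G H G' H' : graph) : cohom_equiv G G' -> cohom_equiv H H' ->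
  cohom_equiv (strong_product G H) (strong_product G' H').
Proof. by move=> [? ?] [? ?]; split; exact: cohom_le_product. Qed.

Lemma unionC (G H : graph) : cohom_equiv (disjoint_union G H) (disjoint_union H G).
Proof.
suff le A B : cohom_le (disjoint_union A B) (disjoint_union B A) by split.
apply/cohom_leP.
exists (fun u => match u with inl a => inr a | inr x => inl x end).
move=> [a|x] [b|y] uv //.
- exact/far_inr/(inl_far uv).
- exact/far_inl/(inr_far uv).
Qed.

Lemma unionA (G H K : graph) : cohom_equiv (disjoint_union G (disjoint_union H K))
  (disjoint_union (disjoint_union G H) K).
Proof.
split; apply/cohom_leP.
- exists (fun u => match u with
    | inl a => inl (inl a) | inr (inl x) => inl (inr x) | inr (inr s) => inr s
    end) => -[a|[x|s]] [b|[y|t]] uv;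
    try solve [by [] | exact/far_inl | exact/far_inr].
  + exact/far_inl/far_inl/(inl_far uv).
  + exact/far_inl/far_inr/(inl_far (inr_far uv)).
  + exact/far_inr/(inr_far (inr_far uv)).
- exists (fun u => match u with
    | inl (inl a) => inl a | inl (inr x) => inr (inl x) | inr s => inr (inr s)
    end) => -[[a|x]|s] [[b|y]|t] uv;
    try solve [by [] | exact/far_inl | exact/far_inr].
  + exact/far_inl/(inl_far (inl_far uv)).
  + exact/far_inr/far_inl/(inr_far (inl_far uv)).
  + exact/far_inr/far_inr/(inr_far uv).
Qed.

Lemma union0 (G : graph) : cohom_equiv (disjoint_union (edgeless 0) G) G.
Proof.
split; apply/cohom_leP; last by exists inr => x y; exact: far_inr.
exists (fun u => match u with inl i => ord0_elim _ i | inr x => x end).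
by move=> [[]//|x] [[]//|y] /inr_far.
Qed.

Lemma productC (G H : graph) : cohom_equiv (strong_product G H) (strong_product H G).
Proof.
suff le A B : cohom_le (strong_product A B) (strong_product B A) by split.
apply/cohom_leP; exists (fun u => (u.2, u.1)) => u v /far_product uv.
by apply/far_product => /=; case: uv; [right|left].
Qed.

Lemma productA (G H K : graph) : cohom_equiv (strong_product G (strong_product H K))
  (strong_product (strong_product G H) K).
Proof.
split; apply/cohom_leP.
- exists (fun u => ((u.1, u.2.1), u.2.2)) => u v.
  move=> /far_product[uv|/far_product[uv|uv]]; apply/far_product.
  + by left; apply/far_product; left.
  + by left; apply/far_product; right.
  + by right.
- exists (fun u => (u.1.1, (u.1.2, u.2))) => u v.
  move=> /far_product[/far_product[uv|uv]|uv]; apply/far_product.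
  + by left.
  + by right; apply/far_product; left.
  + by right; apply/far_product; right.
Qed.

Lemma product1 (G : graph) : cohom_equiv (strong_product (edgeless 1) G) G.
Proof.
split; apply/cohom_leP.
- exists snd => u v /far_product[/far_edgeless|//]; by rewrite !ord1.
- by exists (fun x => (ord0, x)) => x y xy; apply/far_product; right.
Qed.

Lemma product0 (G : graph) : cohom_equiv (strong_product (edgeless 0) G) (edgeless 0).
Proof.
split; last exact: edgeless0_le.
by apply/cohom_leP; exists fst => -[[]].
Qed.

Lemma productDl (G H K : graph) : cohom_equiv (strong_product (disjoint_union G H) K)
  (disjoint_union (strong_product G K) (strong_product H K)).
Proof.
split; apply/cohom_leP.
- exists (fun u => match u with
    | (inl a, s) => inl (a, s) | (inr x, s) => inr (x, s) end).
  move=> [[a|x] s] [[b|y] t] /far_product uv //.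
  + apply/far_inl/far_product => /=.
    by case: uv => uv; [left; exact: inl_far uv|right].
  + apply/far_inr/far_product => /=.
    by case: uv => uv; [left; exact: inr_far uv|right].
- exists (fun u => match u with
    | inl (a, s) => (inl a, s) | inr (x, s) => (inr x, s) end).
  move=> [[a s]|[x s]] [[b t]|[y t]] uv; apply/far_product => /=.
  + case: (iffLR (far_product _ _) (inl_far uv)); last by right.
    by left; exact: far_inl.
  + by left.
  + by left.
  + case: (iffLR (far_product _ _) (inr_far uv)); last by right.
    by left; exact: far_inr.
Qed.

Lemma union_edgeless m n :
  cohom_equiv (disjoint_union (edgeless m) (edgeless n)) (edgeless (m + n)).
Proof.
split.
- apply: (@cohom_le_edgeless (disjoint_union (edgeless m) (edgeless n)) _ (@unsplit m n)).
  exact: can_inj unsplitK.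
- apply/cohom_leP; exists (@fintype.split m n) => i j /far_edgeless ij.
  have {ij} : fintype.split i <> fintype.split j by move/(can_inj (@splitK m n)).
  case: (fintype.split i) (fintype.split j) => [a|x] [b|y] ij //.
  + by apply/far_inl/far_edgeless => E; apply: ij; rewrite E.
  + by apply/far_inr/far_edgeless => E; apply: ij; rewrite E.
Qed.

(** A copy of a finite graph on a type [ 'I_n ].  The type of all finite graphs
    is too large to carry the structure of a semiring, but each finite graph
    is isomorphic to one of these. *)
Record ord_graph := OrdGraph {
  og_order : nat;
  og_adj : 'I_og_order -> 'I_og_order -> Prop;
  og_sym : forall u v, og_adj u v -> og_adj v u;
  og_irr : forall u, ~ og_adj u u }.

Definition fin_of_ord (g : ord_graph) : fin_graph :=
  @FinGraph (Graph (@og_sym g) (@og_irr g)) (@finite_finset _ [set: 'I_(og_order g)]).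

Lemma fin_graph_bij (G : fin_graph) :
  exists n (f : G -> 'I_n) (g : 'I_n -> G), cancel f g /\ cancel g f.
Proof.
have [n /card_bijP[f [g fg gf]]] := fin_graph_finite G.
have lt (x : G) : (val (f (SigSub (mem_set (I : [set: G] x)))) < n)%N.
  by have := valP (f (SigSub (mem_set (I : [set: G] x)))); rewrite inE.
pose h (i : 'I_n) : [set: G] := g (SigSub (mem_set (ltn_ord i : `I_n i))).
exists n, (fun x => Ordinal (lt x)), (fun i => val (h i)); split.
- move=> x; rewrite /h /=.
  set y := SigSub _; have -> : y = f (SigSub (mem_set (I : [set: G] x))).
    exact: val_inj.
  by rewrite fg.
- move=> i; apply: val_inj => /=; set y := SigSub _.
  have -> : y = h i by exact: val_inj.
  by rewrite /h gf.
Qed.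

Lemma fin_graph_equiv (G : fin_graph) :
  exists g : ord_graph, cohom_equiv (fin_of_ord g) G.
Proof.
have [n [f [h [fh hf]]]] := fin_graph_bij G.
have sym i j : adj (h i) (h j) -> adj (h j) (h i) by exact: adj_sym.
have irr i : ~ adj (h i) (h i) by exact: adj_irr.
exists (OrdGraph sym irr); split; apply/cohom_leP.
- by exists h => i j [ij nij]; split=> // /(can_inj hf).
- by exists f => x y [xy nxy]; split=> /= [/(can_inj fh)//|]; rewrite !fh.
Qed.

(** Finite graphs up to mutual cohomomorphism.  A class is represented by the set
    of its members on the types [ 'I_n ], so that equal classes are Leibniz
    equal and the semiring laws hold as equations. *)
Definition graph_class_of (G : fin_graph) : set ord_graph :=
  [set g | cohom_equiv (fin_of_ord g) G].

Definition graph_class : Type :=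
  {A : set ord_graph | exists g, A = graph_class_of (fin_of_ord g)}.

HB.instance Definition _ := gen_eqMixin graph_class.
HB.instance Definition _ := gen_choiceMixin graph_class.

Lemma graph_class_ofP (G H : fin_graph) :
  graph_class_of G = graph_class_of H <-> cohom_equiv G H.
Proof.
split=> [E|GH].
- have [g gG] := fin_graph_equiv G.
  have : graph_class_of H g by rewrite -E.
  exact/cohom_equiv_trans/cohom_equiv_sym.
- apply/seteqP; split=> g gE; first exact: cohom_equiv_trans GH.
  exact/(cohom_equiv_trans gE)/cohom_equiv_sym.
Qed.

Lemma class_subproof (G : fin_graph) :
  exists g, graph_class_of G = graph_class_of (fin_of_ord g).
Proof.
have [g gG] := fin_graph_equiv G; exists g.
exact/graph_class_ofP/cohom_equiv_sym.
Qed.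

Definition cl (G : fin_graph) : graph_class := exist _ _ (class_subproof G).

Definition rep (x : graph_class) : fin_graph := fin_of_ord (projT1 (cid (svalP x))).

Lemma clP (G H : fin_graph) : cl G = cl H <-> cohom_equiv G H.
Proof.
rewrite -graph_class_ofP; split=> [[]//|E].
exact: eq_exist.
Qed.

Lemma repK : cancel rep cl.
Proof.
case=> A AP; rewrite /rep; case: cid => g /= gE.
by apply: eq_exist; rewrite gE.
Qed.

Lemma clK (G : fin_graph) : cohom_equiv (rep (cl G)) G.
Proof. by apply/clP; rewrite repK. Qed.

Definition class_add (x y : graph_class) := cl (fin_disjoint_union (rep x) (rep y)).
Definition class_mul (x y : graph_class) := cl (fin_strong_product (rep x) (rep y)).

Lemma class_addE G H : class_add (cl G) (cl H) = cl (fin_disjoint_union G H).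
Proof. by apply/clP/cohom_equiv_union; exact: clK. Qed.

Lemma class_mulE G H : class_mul (cl G) (cl H) = cl (fin_strong_product G H).
Proof. by apply/clP/cohom_equiv_product; exact: clK. Qed.

Lemma class_addA : associative class_add.
Proof.
move=> x y z; rewrite -(repK x) -(repK y) -(repK z) !class_addE.
by apply/clP; exact: unionA.
Qed.

Lemma class_addC : commutative class_add.
Proof.
by move=> x y; rewrite -(repK x) -(repK y) !class_addE; apply/clP; exact: unionC.
Qed.

Lemma class_add0 : left_id (cl (fin_edgeless 0)) class_add.
Proof.
by move=> x; rewrite -(repK x) class_addE; apply/clP; exact: union0.
Qed.

HB.instance Definition _ :=
  GRing.isNmodule.Build graph_class class_addA class_addC class_add0.

Lemma class_mulA : associative class_mul.
Proof.
move=> x y z; rewrite -(repK x) -(repK y) -(repK z) !class_mulE.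
by apply/clP; exact: productA.
Qed.

Lemma class_mulC : commutative class_mul.
Proof.
by move=> x y; rewrite -(repK x) -(repK y) !class_mulE; apply/clP; exact: productC.
Qed.

Lemma class_mul1 : left_id (cl (fin_edgeless 1)) class_mul.
Proof.
by move=> x; rewrite -(repK x) class_mulE; apply/clP; exact: product1.
Qed.

Lemma class_mulDl : left_distributive class_mul +%R.
Proof.
move=> x y z; rewrite -(repK x) -(repK y) -(repK z).
rewrite [cl _ + _]class_addE !class_mulE [RHS]class_addE.
by apply/clP; exact: productDl.
Qed.

Lemma class_mul0 : left_zero 0 class_mul.
Proof.
by move=> x; rewrite -(repK x) class_mulE; apply/clP; exact: product0.
Qed.

Lemma class_1_neq0 : cl (fin_edgeless 1) != 0.
Proof.
apply/eqP => /clP[/cohom_leP[f _] _].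
by case: (f ord0).
Qed.

HB.instance Definition _ := GRing.Nmodule_isComNzSemiRing.Build graph_class
  class_mulA class_mulC class_mul1 class_mulDl class_mul0 class_1_neq0.

Lemma clD G H : cl (fin_disjoint_union G H) = cl G + cl H.
Proof. by rewrite -class_addE. Qed.

Lemma clM G H : cl (fin_strong_product G H) = cl G * cl H.
Proof. by rewrite -class_mulE. Qed.

Lemma cl_edgeless n : cl (fin_edgeless n) = n%:R.
Proof.
elim: n => [//|n IHn]; rewrite -add1n natrD -IHn -[1%:R]/(cl (fin_edgeless 1)).
by rewrite -clD; apply/clP/cohom_equiv_sym/union_edgeless.
Qed.

Definition class_le (x y : graph_class) : Prop := cohom_le (rep x) (rep y).

Lemma class_leP (G H : fin_graph) : class_le (cl G) (cl H) <-> cohom_le G H.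
Proof.
have [GG' G'G] := clK G; have [HH' H'H] := clK H.
split=> GH; first exact: cohom_le_trans G'G (cohom_le_trans GH HH').
exact: cohom_le_trans GG' (cohom_le_trans GH H'H).
Qed.

(** The pigeonhole principle gives nontriviality.  A graph with a vertex is above
    the one-vertex graph, and a graph with [n] vertices is below the edgeless
    graph with [n] vertices. *)
Lemma class_le_strassen : strassen_preorder class_le.
Proof.
split.
- split.
  + by move=> a; exact: cohom_le_refl.
  + by move=> b a c; exact: cohom_le_trans.
  + move=> c a b ab; rewrite -(repK a) -(repK b) -(repK c) -!clD.
    by apply/class_leP/cohom_le_union => //; exact: cohom_le_refl.
  + move=> c a b ab; rewrite -(repK a) -(repK b) -(repK c) -!clM.
    by apply/class_leP/cohom_le_product => //; exact: cohom_le_refl.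
- move=> n; rewrite -!cl_edgeless => /class_leP/cohom_leP[f fP].
  have : injective f by move=> i j; apply: contraPP => /far_edgeless/fP[].
  by move/leq_card; rewrite !card_ord ltnn.
- by move=> a; rewrite -(repK a); apply/class_leP; exact: edgeless0_le.
- move=> a; have [[x _]|a0] := pselect (exists x : rep a, True).
    right; rewrite -(repK a) -[1]/(cl (fin_edgeless 1)).
    by apply/class_leP; exact: edgeless1_le x.
  left; rewrite -(repK a); apply/clP; split; last exact: edgeless0_le.
  apply/cohom_leP; exists (fun x => False_rect _ (a0 (ex_intro _ x I))) => x.
  by case: a0; exists x.
- move=> a; have [n [f [g [fg _]]]] := fin_graph_bij (rep a); exists n.
  rewrite -(repK a) -cl_edgeless; apply/class_leP.
  exact: cohom_le_edgeless (can_inj fg).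
Qed.

Lemma spectrum_of_spectral_point (R : realType) (F : graph_class -> R) :
  spectral_point class_le F -> asymptotic_spectrum (fun G => F (cl G)).
Proof.
case=> FD FM Fn Fle; split=> [G|G H|G H|n|G H GH].
- by rewrite -[0](Fn 0%N); apply: Fle; exact: (strassen_ge0 class_le_strassen).
- by rewrite clD FD.
- by rewrite clM FM.
- by rewrite cl_edgeless Fn.
- exact/Fle/class_leP.
Qed.

Lemma asymptotic_spectrum_nonempty (R : realType) :
  exists F : fin_graph -> R, asymptotic_spectrum F.
Proof.
have [F FP] := spectral_point_exists R class_le_strassen.
by exists (fun G => F (cl G)); exact: spectrum_of_spectral_point.
Qed.

(** * Strong powers *)

Lemma cohom_le_power (G H : graph) n :
  cohom_le G H -> cohom_le (strong_power G n) (strong_power H n).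
Proof.
move=> GH; elim: n => [|n IHn]; first exact: cohom_le_refl.
exact: cohom_le_product.
Qed.

Lemma cohom_le_power_exp (G : graph) (x : G) m n :
  (m <= n)%N -> cohom_le (strong_power G m) (strong_power G n).
Proof.
move=> /subnK <-; elim: (n - m)%N => [|k IHk]; first exact: cohom_le_refl.
apply: cohom_le_trans IHk _; apply/cohom_leP; exists (fun u => (x, u)) => u v uv.
by apply/far_product; right.
Qed.

Definition fin_strong_power (G : fin_graph) (n : nat) : fin_graph :=
  iter n (fin_strong_product G) (fin_edgeless 1).

Lemma fin_strong_powerE (G : fin_graph) n :
  fin_strong_power G n = strong_power G n :> graph.
Proof. by elim: n => [//|n IHn]; rewrite /strong_power /= -/(strong_power _ _) -IHn. Qed.

Lemma cl_power (G : fin_graph) n : cl (fin_strong_power G n) = cl G ^+ n.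
Proof. by elim: n => [//|n IHn]; rewrite exprS -IHn -clM. Qed.

Lemma spectrum_power (R : realType) (F : fin_graph -> R) (G : fin_graph) n :
  asymptotic_spectrum F -> F (fin_strong_power G n) = F G ^+ n.
Proof.
case=> _ _ FM Fn _; elim: n => [|n IHn]; first by rewrite expr0; exact: (Fn 1%N).
by rewrite exprS -IHn -FM.
Qed.

Lemma spectrum_ge1 (R : realType) (F : fin_graph -> R) (G : fin_graph) (x : G) :
  asymptotic_spectrum F -> 1 <= F G.
Proof.
case=> _ _ _ Fn Fle; have <- : F (fin_edgeless 1) = 1 by exact: (Fn 1%N).
exact/Fle/(edgeless1_le x).
Qed.

(** * Circle graphs and fraction graphs *)

Section Circle.
Variable R : realType.
Implicit Types (r s : R) (x y : circle R).

Lemma circle_dist_le_half x y : circle_dist x y <= 1 / 2.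
Proof.
by rewrite /circle_dist ge_min; case: (lerP `|val x - val y| (1 / 2)) => //= ?; lra.
Qed.

Lemma circle_dist0 x : circle_dist x x = 0.
Proof. by rewrite /circle_dist subrr normr0 subr0 min_l. Qed.

Lemma far_open r x y : 0 < r ->
  @far (open_circle_graph r) x y <-> 1 / r <= circle_dist x y.
Proof.
move=> r0; have r'0 : 0 < 1 / r by rewrite divr_gt0.
split=> [[xy nxy]|rxy].
  by rewrite leNgt; apply/negP => lt; apply: nxy; split.
split=> [E|[_]]; last by rewrite ltNge rxy.
by move: rxy; rewrite E circle_dist0 leNgt r'0.
Qed.

Lemma far_closed r x y : 0 < r ->
  @far (closed_circle_graph r) x y <-> 1 / r < circle_dist x y.
Proof.
move=> r0; have r'0 : 0 < 1 / r by rewrite divr_gt0.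
split=> [[xy nxy]|rxy].
  by rewrite ltNge; apply/negP => lt; apply: nxy; split.
split=> [E|[_]]; last by rewrite leNgt rxy.
by move: rxy; rewrite E circle_dist0 ltNge ltW.
Qed.

Lemma open_circle_mono r s : 0 < r -> r <= s ->
  cohom_le (open_circle_graph r) (open_circle_graph s).
Proof.
move=> r0 rs; have s0 := lt_le_trans r0 rs.
apply/cohom_leP; exists id => x y /(far_open _ _ r0) xy; apply/(far_open _ _ s0).
by apply: le_trans xy; rewrite !div1r lef_pV2.
Qed.

Lemma open_le_closed_circle r s : 0 < r -> r < s ->
  cohom_le (open_circle_graph r) (closed_circle_graph s).
Proof.
move=> r0 rs; have s0 := lt_trans r0 rs.
apply/cohom_leP; exists id => x y /(far_open _ _ r0) xy; apply/(far_closed _ _ s0).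
by apply: lt_le_trans xy; rewrite !div1r ltf_pV2.
Qed.

Lemma closed_le_open_circle r :
  0 < r -> cohom_le (closed_circle_graph r) (open_circle_graph r).
Proof.
move=> r0; apply/cohom_leP; exists id => x y /(far_closed _ _ r0)/ltW xy.
exact/far_open.
Qed.

Lemma far_fraction (a b : nat) (i j : fraction_graph a b) :
  (0 < b)%N -> (2 * b <= a)%N -> (i < j)%N ->
  far i j <-> (i + b <= j)%N /\ (j + b <= i + a)%N.
Proof.
move=> b0 ba ij; have ja := ltn_ord j.
have Eji : ((j%:Z - i%:Z) %% a%:Z)%Z = j%:Z - i%:Z.
  by apply: modz_small; apply/andP; split; lia.
have Eij : ((i%:Z - j%:Z) %% a%:Z)%Z = i%:Z - j%:Z + a%:Z.
  by rewrite -modzDr; apply: modz_small; apply/andP; split; lia.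
have ne : i <> j by move=> E; move: ij; rewrite E ltnn.
rewrite /far /= /fraction_adj ba Eji Eij; split=> [[_ nij]|[h1 h2]].
- by split; rewrite leqNgt; apply/negP => h; apply: nij; split=> //; [right|left]; lia.
- by split=> // -[_ [h|h]]; lia.
Qed.

Lemma fraction_complete (a b : nat) :
  (a < 2 * b)%N -> cohom_le (fraction_graph a b) (edgeless 1).
Proof.
move=> ab; apply/cohom_leP; exists (fun=> ord0) => i j [ij nij].
by case: nij; split=> //; rewrite leqNgt ab.
Qed.

Lemma fraction_le_open (a b : nat) : (0 < b)%N -> (2 * b <= a)%N ->
  cohom_le (fraction_graph a b) (open_circle_graph (a%:R / b%:R : R)).
Proof.
move=> b0 ba; have a0 : (0 < a)%N by lia.
have aR : 0 < a%:R :> R by rewrite ltr0n.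
have bR : 0 < b%:R :> R by rewrite ltr0n.
have pos (i : 'I_a) : 0 <= (i%:R / a%:R : R) < 1.
  by rewrite divr_ge0 //= ltr_pdivrMr // mul1r ltr_nat.
pose pt (i : 'I_a) : circle R := exist _ (i%:R / a%:R) (pos i).
apply/cohom_leP; exists pt.
suff lt (i j : 'I_a) : (i < j)%N -> @far (fraction_graph a b) i j ->
    @far (open_circle_graph (a%:R / b%:R : R)) (pt i) (pt j).
  move=> i j ij; have [ltij|ltji|E] := ltngtP i j; first exact: lt.
    exact/far_sym/lt/far_sym.
  by case: ij => + _; case; apply: val_inj.
move=> ij /(far_fraction b0 ba ij)[h1 h2]; apply/far_open; first exact: divr_gt0.
rewrite /circle_dist /= -mulrBl.
have -> : `|(i%:R - j%:R) / a%:R| = (j%:R - i%:R) / a%:R :> R.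
  by rewrite normrM distrC !ger0_norm ?invr_ge0 ?subr_ge0 ?ler_nat // ltnW.
have H1 : i%:R + b%:R <= j%:R :> R by rewrite -natrD ler_nat.
have H2 : j%:R + b%:R <= i%:R + a%:R :> R by rewrite -!natrD ler_nat.
rewrite div1r invf_div le_min; apply/andP; split.
  by rewrite ler_pM2r ?invr_gt0 //; lra.
have -> : 1 - (j%:R - i%:R) / a%:R = (a%:R - (j%:R - i%:R)) / a%:R :> R.
  by rewrite [RHS]mulrBl divff // gt_eqF.
by rewrite ler_pM2r ?invr_gt0 //; lra.
Qed.

(** Rounding down commutes with adding the integer [q], so points whose rescaled
    distance is at least [q] have integer parts at distance at least [q], in
    both directions around the circle. *)
Lemma open_le_fraction (p q : nat) : (0 < q)%N -> (2 * q <= p)%N ->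
  cohom_le (open_circle_graph (p%:R / q%:R : R)) (fraction_graph p q).
Proof.
move=> q0 qp; have p0 : (0 < p)%N by lia.
have pR : 0 < p%:R :> R by rewrite ltr0n.
have qR : 0 < q%:R :> R by rewrite ltr0n.
have [fl flP] : exists fl : circle R -> nat, forall x,
    (fl x)%:R <= p%:R * val x < (fl x)%:R + 1.
  exists (fun x => Num.truncn (p%:R * val x)) => x; rewrite natr1 truncn_itv //.
  by case: x => x /= /andP[? _]; exact: mulr_ge0.
have lt x : (fl x < p)%N.
  have /andP[l _] := flP x; rewrite -(ltr_nat R); apply: le_lt_trans l _.
  by case: x => x /= /andP[_ x1]; rewrite -[ltRHS]mulr1 ltr_pM2l.
apply/cohom_leP; exists (fun x : circle R => Ordinal (lt x) : fraction_graph p q).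
suff H x y : val x < val y -> @far (open_circle_graph (p%:R / q%:R : R)) x y ->
    @far (fraction_graph p q) (Ordinal (lt x)) (Ordinal (lt y)).
  move=> x y xy; have [ltij|ltji|E] := ltgtP (val x) (val y); first exact: H.
    exact/far_sym/H/far_sym.
  by case: xy => + _; case; apply: val_inj.
move=> xy /far_open; rewrite divr_gt0 // => /(_ isT).
rewrite /circle_dist distrC gtr0_norm ?subr_gt0 // le_min div1r invf_div.
rewrite !ler_pdivrMr // => /andP[d1 d2].
have /andP[l1 u1] := flP x; have /andP[l2 u2] := flP y.
have h1 : (fl x + q <= fl y)%N.
  by rewrite -ltnS -(ltr_nat R) -natr1 natrD; lra.
have h2 : (fl y + q <= fl x + p)%N.
  by rewrite -ltnS -(ltr_nat R) -natr1 !natrD; lra.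
by apply/far_fraction => //=; lia.
Qed.

(** If [a / b < 2], then [r < 2] and all distances on the circle, being at most
    [1 / 2], are less than [1 / r]: the open circle graph is complete too, as
    is the fraction graph by convention. *)
Lemma open_le_fraction_ge r (a b : nat) : (0 < a)%N -> (0 < b)%N ->
  0 < r -> r <= a%:R / b%:R ->
  cohom_le (open_circle_graph r) (fraction_graph a b).
Proof.
move=> a0 b0 r0 rab; have [ba|ab] := leqP (2 * b) a.
  exact: cohom_le_trans (open_circle_mono r0 rab) (open_le_fraction b0 ba).
apply: (@cohom_le_trans (edgeless 1)); last first.
  exact: (@edgeless1_le (fraction_graph a b) (Ordinal a0)).
have r2 : r < 2.
  apply: le_lt_trans rab _; rewrite ltr_pdivrMr ?ltr0n //.
  by rewrite -natrM ltr_nat.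
apply/cohom_leP; exists (fun=> ord0) => x y /(far_open _ _ r0) d.
exfalso; move: d; apply/negP; rewrite -ltNge; apply: le_lt_trans (circle_dist_le_half x y) _.
by rewrite !div1r ltf_pV2 ?posrE.
Qed.

Lemma fraction_mono (a b p q : nat) :
  (0 < b)%N -> (0 < p)%N -> (0 < q)%N -> a%:R / b%:R <= p%:R / q%:R :> R ->
  cohom_le (fraction_graph a b) (fraction_graph p q).
Proof.
move=> b0 p0 q0 ab_pq; have [ba|ab] := leqP (2 * b) a; last first.
  apply: cohom_le_trans (fraction_complete ab) _.
  exact: (@edgeless1_le (fraction_graph p q) (Ordinal p0)).
apply: cohom_le_trans (fraction_le_open b0 ba) _.
apply: open_le_fraction_ge => //; rewrite divr_gt0 ?ltr0n //; lia.
Qed.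

(** Used with [f = id] between circle graphs of different parameters: their powers
    have the same points, but convertible vertex types only for a numeral
    exponent. *)
Fixpoint power_map (G H : graph) (f : G -> H) n :
    strong_power G n -> strong_power H n :=
  match n with
  | 0%N => id
  | m.+1 => fun u : strong_power G m.+1 =>
      (f u.1, power_map f u.2) : strong_power H m.+1
  end.

Lemma closed_far_near_left r n (u v : strong_power (closed_circle_graph r) n) :
  0 < r -> far u v ->
  \forall s \near r^'-, far
    (@power_map (closed_circle_graph r) (open_circle_graph s) id n u)
    (@power_map (closed_circle_graph r) (open_circle_graph s) id n v).
Proof.
move=> r0; elim: n u v => [u v /far_edgeless|n IHn u v].
  by rewrite !ord1.
move=> /far_product[/(far_closed _ _ r0) uv|/IHn uv].
  have d0 : 0 < circle_dist u.1 v.1 by apply: lt_trans uv; rewrite divr_gt0.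
  have dr : 1 / circle_dist u.1 v.1 < r.
    by move: uv; rewrite ltr_pdivrMr // mulrC -ltr_pdivrMr.
  near=> s.
  have ds : 1 / circle_dist u.1 v.1 < s by near: s; exact: nbhs_left_gt.
  have s0 : 0 < s by apply: lt_trans ds; rewrite divr_gt0.
  apply/far_product; left; apply/far_open => //.
  by move: ds; rewrite ltr_pdivrMr // mulrC -ltr_pdivrMr // => /ltW.
near=> s; apply/far_product; right => /=.
by near: s.
Unshelve. all: by end_near.
Qed.

(** A finite subset of a power of the closed circle graph realizes only finitely
    many distances, so those exceeding [1 / r] also exceed [1 / s] for all
    [s < r] close to [r]. *)
Lemma finite_le_closed_near_left (G : fin_graph) r n : 0 < r ->
  cohom_le G (strong_power (closed_circle_graph r) n) ->
  \forall s \near r^'-, cohom_le G (strong_power (open_circle_graph s) n).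
Proof.
move=> r0 /cohom_leP[f fP]; have [k [g [h [gh hg]]]] := fin_graph_bij G.
pose pm s := @power_map (closed_circle_graph r) (open_circle_graph s) id n.
have : \forall s \near r^'-, forall ij : 'I_k * 'I_k,
    far (h ij.1) (h ij.2) -> far (pm s (f (h ij.1))) (pm s (f (h ij.2))).
  apply: filter_forall => -[i j] /=.
  have [/fP/(closed_far_near_left r0)|nij] := pselect (far (h i) (h j)).
    by apply: filterS => s.
  by apply: nearW.
apply: filterS => s sP; apply/cohom_leP; exists (pm s \o f) => u v uv.
by have := sP (g u, g v); rewrite /= !gh; exact.
Qed.

Lemma fraction_power_le_near (p q n m : nat) (r : R) :
  (0 < q)%N -> (2 * q <= p)%N -> r = p%:R / q%:R ->
  cohom_le (strong_power (open_circle_graph r) n)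
    (strong_power (closed_circle_graph r) m) ->
  exists2 s, s < r & forall a b : nat, (0 < a)%N -> (0 < b)%N ->
    s <= a%:R / b%:R ->
    cohom_le (fin_strong_power (fraction_graph p q) n)
      (fin_strong_power (fraction_graph a b) m).
Proof.
move=> q0 qp rE le_oc; have r0 : 0 < r by rewrite rE divr_gt0 ?ltr0n //; lia.
have /(finite_le_closed_near_left r0) Gs :
    cohom_le (fin_strong_power (fraction_graph p q) n)
      (strong_power (closed_circle_graph r) m).
  rewrite fin_strong_powerE; apply: cohom_le_trans le_oc; apply: cohom_le_power.
  by rewrite rE; exact: fraction_le_open.
near r^'- => s.
have Gs' : cohom_le (fin_strong_power (fraction_graph p q) n)
    (strong_power (open_circle_graph s) m) by near: s.
have s0 : 0 < s by near: s; exact: nbhs_left_gt.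
have sr : s < r by near: s; exact: nbhs_left_lt.
exists s => // a b a0 b0 sab; apply: cohom_le_trans Gs' _.
rewrite fin_strong_powerE; apply: cohom_le_power.
exact: open_le_fraction_ge.
Unshelve. all: by end_near.
Qed.

End Circle.

(** * Convergence in the asymptotic spectrum distance *)

(** Nonemptiness of the spectrum enters in both directions, to make the distance
    a nonnegative number rather than [-oo]. *)
Lemma spectrum_convergesP (R : realType) (G : nat -> fin_graph) (H : fin_graph) :
  spectrum_converges R G H <->
  forall e : R, 0 < e -> \forall i \near \oo,
    forall F : fin_graph -> R, asymptotic_spectrum F -> `|F (G i) - F H| <= e.
Proof.
have [F0 F0P] := asymptotic_spectrum_nonempty R.
have ge0 i : (0 <= spectrum_dist R (G i) H)%E.
  apply: (@le_trans _ _ `|F0 (G i) - F0 H|%:E); first by rewrite lee_fin.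
  by apply: ereal_sup_ubound; exists F0.
split=> [/fine_cvgP[fin /cvgrPdist_le cvg] e e0|cvg].
- near=> i => F FP; rewrite -lee_fin.
  apply: (@le_trans _ _ (spectrum_dist R (G i) H)).
    by apply: ereal_sup_ubound; exists F.
  have fini : spectrum_dist R (G i) H \is a fin_num by near: i.
  rewrite -(fineK fini) lee_fin -[leLHS]ger0_norm ?fine_ge0 //.
  rewrite -normrN -[X in `|X|]sub0r; near: i; exact: cvg.
- have le e : 0 < e -> \forall i \near \oo, (spectrum_dist R (G i) H <= e%:E)%E.
    move=> /cvg; apply: filterS => i iP; apply: ge_ereal_sup => _ [F FP ->].
    by rewrite lee_fin; exact: iP.
  apply/fine_cvgP; split.
    apply: filterS (le 1 ltr01) => i i1.
    by rewrite ge0_fin_numE //; apply: le_lt_trans i1 _; rewrite ltry.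
  apply/cvgrPdist_le => e /le; apply: filterS => i ie /=.
  have fini : spectrum_dist R (G i) H \is a fin_num.
    by rewrite ge0_fin_numE //; apply: le_lt_trans ie _; rewrite ltry.
  by rewrite sub0r normrN ger0_norm ?fine_ge0 // -lee_fin fineK.
Unshelve. all: by end_near.
Qed.

(** This is [x <= y * y ^ (f / n) <= y * P ^ (1 / m)] without roots: all
    inequalities are raised to the power [n * m]. *)
Lemma root_bound (R : realFieldType) (x y P e : R) (n m f : nat) :
  (0 < n)%N -> (0 < m)%N -> (f * m <= n)%N -> 0 <= x -> 1 <= y -> y <= P -> 0 <= e ->
  P <= (1 + e) ^+ m -> x ^+ n <= y ^+ (n + f) -> x <= (1 + e) * y.
Proof.
move=> n0 m0 fmn x0 y1 yP e0 Pem xy.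
have y0 : 0 <= y by apply: le_trans y1.
rewrite -(@ler_pXn2r _ (n * m)) ?nnegrE ?muln_gt0 ?n0 ?mulr_ge0 ?addr_ge0 //.
rewrite exprM; apply: (@le_trans _ _ ((y ^+ (n + f)) ^+ m)).
  by apply: lerXn2r; rewrite ?nnegrE ?exprn_ge0.
rewrite -exprM mulnDl exprD exprMn mulrC.
apply: ler_wpM2r; first exact: exprn_ge0.
rewrite [(n * m)%N]mulnC [(1 + e) ^+ _]exprM.
apply: (@le_trans _ _ (y ^+ n)); first exact: ler_weXn2l.
by apply: lerXn2r; rewrite ?nnegrE ?exprn_ge0 ?addr_ge0 //; apply: le_trans Pem.
Qed.

Lemma bernoulli_le (R : realDomainType) (x : R) (n : nat) :
  -1 <= x -> 1 + n%:R * x <= (1 + x) ^+ n.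
Proof.
move=> x1; elim: n => [|n IHn]; first by rewrite mul0r addr0 expr0.
rewrite exprS; have x1' : 0 <= 1 + x by lra.
apply: le_trans (ler_wpM2l x1' IHn); rewrite -natr1.
have : 0 <= n%:R * (x * x) by rewrite mulr_ge0 // -expr2 sqr_ge0.
lra.
Qed.

Lemma exists_expr_ge (R : archiRealFieldType) (P e : R) :
  0 < e -> exists2 m : nat, (0 < m)%N & P <= (1 + e) ^+ m.
Proof.
move=> e0; exists (Num.truncn (P / e)).+1 => //.
have e1 : -1 <= e by lra.
apply: le_trans (bernoulli_le _ e1).
have := truncnS_gt (P / e); rewrite ltr_pdivrMr //; lra.
Qed.

Lemma spectrum_fraction_bounds (R : realType) (F : fin_graph -> R) (p q : nat) :
  (0 < p)%N -> asymptotic_spectrum F -> 1 <= F (fraction_graph p q) <= p%:R.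
Proof.
move=> p0 FP; rewrite (@spectrum_ge1 _ _ (fraction_graph p q) (Ordinal p0)) //=.
case: FP => _ _ _ Fn Fle; rewrite -Fn; apply: Fle.
exact: (@cohom_le_edgeless (fraction_graph p q) p id).
Qed.

Definition converges_from_below (R : realType) (p q : nat) (r : R) : Prop :=
  forall a b : nat -> nat,
    (forall n, (0 < a n)%N) -> (forall n, (0 < b n)%N) ->
    (forall n, (a n)%:R / (b n)%:R <= r) ->
    (a n)%:R / (b n)%:R @[n --> \oo] --> r ->
    spectrum_converges R (fun n => fraction_graph (a n) (b n))
      (fraction_graph p q).

Lemma asymp_le_fraction_converges (R : realType) (p q : nat) (r : R) :
  (0 < q)%N -> (2 * q <= p)%N -> r = p%:R / q%:R ->
  asymp_le R (open_circle_graph r) (closed_circle_graph r) ->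
  converges_from_below p q r.
Proof.
move=> q0 qp rE [f [/eqoP fo le_oc]] a b a0 b0 ab_le ab_cvg.
have p0 : (0 < p)%N by lia.
apply/spectrum_convergesP => e e0.
have pR : 0 < p%:R :> R by rewrite ltr0n.
have [m m0 mP] := exists_expr_ge p%:R (divr_gt0 e0 pR).
have mR : 0 < m%:R :> R by rewrite ltr0n.
have [n n0 fn] : exists2 n, (0 < n)%N & (f n * m <= n)%N.
  have mi : 0 < m%:R^-1 :> R by rewrite invr_gt0.
  near \oo => n; exists n; first by near: n; exact: nbhs_infty_gt.
  have : `|(f n)%:R : R^o| <= m%:R^-1 * `|n%:R : R^o| by near: n; exact: fo.
  by rewrite !ger0_norm // mulrC ler_pdivlMr // -natrM ler_nat.
have [s sr sP] := fraction_power_le_near q0 qp rE (le_oc n).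
have : \forall i \near \oo, s < (a i)%:R / (b i)%:R.
  exact: (cvgr_gt r).
apply: filterS => i si F FP.
have [FG1 FGp] := andP (spectrum_fraction_bounds q p0 FP).
have [FA1 _] := andP (spectrum_fraction_bounds (b i) (a0 i) FP).
have [_ _ _ _ Fle] := FP.
have AG : F (fraction_graph (a i) (b i)) <= F (fraction_graph p q).
  by apply/Fle/(@fraction_mono R) => //; rewrite -rE.
have := Fle _ _ (sP _ _ (a0 i) (b0 i) (ltW si)).
rewrite !(spectrum_power _ _ FP) => GA.
have FAp := le_trans AG FGp.
have G0 := le_trans ler01 FG1.
have := root_bound n0 m0 fn G0 FA1 FAp (ltW (divr_gt0 e0 pR)) mP GA.
move=> GAe; rewrite ler0_norm ?subr_le0 // opprB.
have : e / p%:R * F (fraction_graph (a i) (b i)) <= e.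
  by rewrite mulrAC ler_pdivrMr // ler_pM2l.
move: GAe; rewrite mulrDl mul1r; lra.
Unshelve. all: by end_near.
Qed.

(** * From convergence to asymptotic equivalence *)

(** Duality applied to [G ^ m] and [3 A ^ m].  The factor [2 * 3 <= 2 ^ 3] costs
    three more factors [A] for each [n], and the constant [K <= 2 ^ K] of the
    duality costs [K] further ones, once. *)
Lemma spectrum_gap_power_le (R : realType) (G A : fin_graph) (m : nat) :
  cohom_le (edgeless 2) A ->
  (forall F : fin_graph -> R, asymptotic_spectrum F -> F G ^+ m < 3 * F A ^+ m) ->
  exists k, forall n, cohom_le (fin_strong_power G (m * n))
    (fin_strong_power A ((m + 3) * n + k)).
Proof.
move=> A2 GA; have S := class_le_strassen.
have nat_le i j : (i <= j)%N -> class_le i%:R j%:R := strassen_natW S (n:=j).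
have A2' : class_le 2%:R (cl A) by rewrite -cl_edgeless; apply/class_leP.
have A1 : class_le 1 (cl A).
  by apply: (spo_trans S _ A2'); exact: (nat_le 1 2 isT).
have AX k : class_le 1 (cl A ^+ k) by rewrite -(expr1n _ k); exact: (spoX S).
have [||k kP] := @strassen_duality R _ class_le (cl G ^+ m) (3%:R * cl A ^+ m) S.
- rewrite -[X in class_le X _]mulr1; apply: (spoM S); [exact: (nat_le 1 3 isT)|exact: AX].
- move=> F FP; have := GA _ (spectrum_of_spectral_point FP).
  have FX (x : graph_class) j : F (x ^+ j) = F x ^+ j.
    elim: j => [|j IHj]; first by rewrite !expr0 (spectral_nat FP 1).
    by rewrite !exprS (spectralM FP) IHj.
  by rewrite (spectralM FP) (spectral_nat FP) !FX.
exists k => n; apply/class_leP; rewrite !cl_power.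
rewrite exprM; apply: (spo_trans S (kP n)).
have -> : cl A ^+ ((m + 3) * n + k) = cl A ^+ k * (cl A ^+ 3 * cl A ^+ m) ^+ n.
  by rewrite -exprD -exprM -exprD addnC [(3 + m)%N]addnC.
apply: (spoM S).
  apply: (spo_trans S (nat_le _ _ (ltnW (@ltn_expl 2 k isT)))).
  by rewrite natrX; exact: (spoX S).
apply: (spoX S); rewrite mulrA; apply: (spo_mulr S).
rewrite -natrM; apply: (spo_trans S (nat_le (2 * 3)%N (2 ^ 3)%N isT)).
by rewrite natrX; exact: (spoX S).
Qed.

(** The least admissible excess does not depend on [m], so its growth rate is at
    most [3 / m] for every [m], and therefore sublinear. *)
Lemma asymp_le_of_slopes (R : realType) (G H : graph) :
  (forall m, (0 < m)%N -> exists k, forall n,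
    cohom_le (strong_power G n) (strong_power H (n + 3 * (n %/ m) + k))) ->
  asymp_le R G H.
Proof.
move=> GH.
have ex n : exists j, `[< cohom_le (strong_power G n) (strong_power H (n + j)) >].
  have [k kP] := GH 1%N isT; exists (3 * (n %/ 1) + k)%N.
  by apply/asboolP; rewrite addnA.
exists (fun n => ex_minn (ex n)); split; last first.
  by move=> n; case: ex_minnP => j /asboolP.
apply/eqoP => e e0.
(* [j <= 3 n / m + k]: the slope [3 / m] uses at most half of [e], and [k] the
   other half once [n] is large. *)
pose m := (Num.truncn (6 / e)).+1.
have me : 6 < e * m%:R.
  by have := truncnS_gt (6 / e); rewrite ltr_pdivrMr // mulrC.
have mR : 0 < m%:R :> R by rewrite ltr0n.
have [k kP] := GH m isT.
near=> n; case: ex_minnP => j _ /(_ (3 * (n %/ m) + k)%N) jP.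
have {}jP : (j <= 3 * (n %/ m) + k)%N by apply: jP; apply/asboolP; rewrite addnA.
rewrite !ger0_norm //.
have nk : k%:R * 2 <= e * n%:R.
  rewrite -ler_pdivrMl //; near: n; exact: nbhs_infty_ger.
have h1 : j%:R <= 3 * (n %/ m)%:R + k%:R :> R.
  by rewrite -[3]/(3%:R) -natrM -natrD ler_nat.
have h2 : (n %/ m)%:R * m%:R <= n%:R :> R by rewrite -natrM ler_nat leq_trunc_div.
have h3 : 6 * (n %/ m)%:R <= e * n%:R.
  apply: le_trans (ler_wpM2l (ltW e0) h2).
  by have := ler_wpM2l (ler0n R (n %/ m)) (ltW me); lra.
lra.
Unshelve. all: by end_near.
Qed.

Lemma edgeless2_le_fraction (a b : nat) :
  (0 < b)%N -> (2 * b <= a)%N -> cohom_le (edgeless 2) (fraction_graph a b).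
Proof.
move=> b0 ba; have lt (i : 'I_2) : (i * b < a)%N by case: i => -[|[]] //=; lia.
pose f (i : 'I_2) : fraction_graph a b := Ordinal (lt i).
suff H (i j : 'I_2) : (i < j)%N -> far (f i) (f j).
  apply: (@edgeless_cohom_le _ _ f) => i j ij.
  have [/H//|/H/far_sym//|/val_inj//] := ltngtP i j.
move=> ij; apply/far_fraction => //=; first by nia.
by move: ij (ltn_ord j) => *; nia.
Qed.

(** The sequence [(p n - 1) / (q n)] approaches [r] strictly from below.  That its
    term is at least [2] is seen on the spectrum: below [2] the fraction graph is
    complete and has spectral value at most [1], which is farther than [e < 1]
    from the value of [E_r], at least [2].  In particular this excludes
    [r = 2]. *)
Lemma exists_fraction_near (R : realType) (p q : nat) (r e : R) :
  (0 < q)%N -> (2 * q <= p)%N -> r = p%:R / q%:R -> 0 < e -> e < 1 ->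
  converges_from_below p q r ->
  exists a b : nat, [/\ (0 < b)%N, (2 * b <= a)%N, a%:R / b%:R < r
    & forall F : fin_graph -> R, asymptotic_spectrum F ->
      F (fraction_graph p q) - e <= F (fraction_graph a b)].
Proof.
move=> q0 qp rE e0 e1 conv.
have qR : 0 < q%:R :> R by rewrite ltr0n.
pose a n := (p * n.+1 - 1)%N; pose b n := (q * n.+1)%N.
have a0 n : (0 < a n)%N by rewrite /a; nia.
have b0 n : (0 < b n)%N by rewrite /b; nia.
have abE n : (a n)%:R / (b n)%:R = r - q%:R^-1 * n.+1%:R^-1 :> R.
  rewrite /a /b natrB; last by nia.
  rewrite !natrM rE.
  have : n.+1%:R != 0 :> R by rewrite pnatr_eq0.
  move: (n.+1%:R : R) => N N0; field.
  by rewrite N0 gt_eqF.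
have lt n : (a n)%:R / (b n)%:R < r.
  by rewrite abE ltrBlDr ltrDl mulr_gt0 ?invr_gt0 // ltr0n.
have cvg : (a n)%:R / (b n)%:R @[n --> \oo] --> r.
  have : r - q%:R^-1 * n.+1%:R^-1 @[n --> \oo] --> r - q%:R^-1 * 0.
    by apply: cvgB; [exact: cvg_cst|apply: cvgMr; exact: cvg_harmonic].
  have -> : (fun n => (a n)%:R / (b n)%:R) = fun n => r - q%:R^-1 * n.+1%:R^-1.
    exact/funext.
  by rewrite mulr0 subr0.
have /spectrum_convergesP/(_ e e0) near_e := conv a b a0 b0 (fun n => ltW (lt n)) cvg.
have [n nP] := filter_ex near_e.
have [F0 F0P] := asymptotic_spectrum_nonempty R.
have close (F : fin_graph -> R) : asymptotic_spectrum F ->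
    F (fraction_graph p q) - e <= F (fraction_graph (a n) (b n)).
  by move=> /nP; rewrite ler_distlC lerBlDr => /andP[_]; lra.
exists (a n), (b n); split=> //.
rewrite leqNgt; apply/negP => /fraction_complete complete.
have [_ _ _ Fn Fle] := F0P.
have := Fle _ (fin_edgeless 1) complete; rewrite Fn.
have := Fle (fin_edgeless 2) _ (edgeless2_le_fraction q0 qp); rewrite Fn.
have := close _ F0P; lra.
Qed.

(** With [e = 1 / (2 m)], Bernoulli's inequality turns
    [F(A) >= F(G) - e >= (1 - e) F(G)] into [F(A) ^ m >= F(G) ^ m / 2]. *)
Lemma fraction_converges_asymp_le (R : realType) (p q : nat) (r : R) :
  (0 < q)%N -> (2 * q <= p)%N -> r = p%:R / q%:R ->
  converges_from_below p q r ->
  asymp_le R (open_circle_graph r) (closed_circle_graph r).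
Proof.
move=> q0 qp rE conv; have p0 : (0 < p)%N by lia.
apply: asymp_le_of_slopes => m m0.
have mR : 0 < m%:R :> R by rewrite ltr0n.
pose e : R := (2 * m%:R)^-1.
have e0 : 0 < e by rewrite invr_gt0 mulr_gt0.
have me : m%:R * e = 1 / 2 by rewrite /e; field; rewrite gt_eqF.
have e1 : e < 1.
  have : 1 * e <= m%:R * e by rewrite ler_pM2r // ler1n.
  rewrite me; lra.
have [a [b [b0 ba abr close]]] := exists_fraction_near q0 qp rE e0 e1 conv.
have gap (F : fin_graph -> R) : asymptotic_spectrum F ->
    F (fraction_graph p q) ^+ m < 3 * F (fraction_graph a b) ^+ m.
  move=> FP; have := close F FP.
  have [G1 _] := andP (spectrum_fraction_bounds q p0 FP).
  have G0 := lt_le_trans ltr01 G1.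
  set G := F (fraction_graph p q) in G1 G0 *.
  set A := F (fraction_graph a b) => GA.
  have GA' : (1 - e) * G <= A.
    apply: le_trans GA; rewrite mulrBl mul1r lerB // ler_peMr //; exact: ltW.
  have bern : 1 - m%:R * e <= (1 - e) ^+ m.
    by rewrite -mulrN; apply: bernoulli_le; rewrite lerN2 ltW.
  have : (1 - e) ^+ m * G ^+ m <= A ^+ m.
    have h : 0 <= (1 - e) * G by rewrite mulr_ge0 ?subr_ge0 ?(ltW e1) ?(ltW G0).
    by rewrite -exprMn; apply: lerXn2r => //; rewrite nnegrE //; exact: le_trans GA'.
  have Gm : 0 < G ^+ m by rewrite exprn_gt0.
  have := ler_wpM2r (ltW Gm) bern; rewrite me; lra.
have [k kP] := spectrum_gap_power_le (edgeless2_le_fraction b0 ba) gap.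
have r0 : 0 < r by rewrite rE divr_gt0 ?ltr0n.
have ab0 : 0 < a%:R / b%:R :> R by rewrite divr_gt0 ?ltr0n //; lia.
have AC : cohom_le (fraction_graph a b) (closed_circle_graph r).
  exact: cohom_le_trans (fraction_le_open R b0 ba) (open_le_closed_circle ab0 abr).
(* [n] is rounded up to the multiple [m * N] of [m]. *)
exists (m + 3 + k)%N => n; set N := (n %/ m).+1.
have nN : (n <= m * N)%N by rewrite mulnC ltnW // ltn_ceil.
have N_le : ((m + 3) * N + k <= n + 3 * (n %/ m) + (m + 3 + k))%N.
  by have := leq_trunc_div n m; rewrite /N; lia.
apply: (@cohom_le_trans (strong_power (fraction_graph p q) n)).
  by apply: cohom_le_power; rewrite rE; exact: open_le_fraction.
apply: cohom_le_trans (cohom_le_power_exp (Ordinal p0 : fraction_graph p q) nN) _.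
rewrite -fin_strong_powerE; apply: cohom_le_trans (kP N) _.
rewrite fin_strong_powerE; apply: cohom_le_trans (cohom_le_power _ AC) _.
apply: cohom_le_power_exp N_le.
by exists 0; rewrite lexx ltr01.
Qed.

Theorem theorem1p4 (R : realType) (p q : nat) (p_gt0 : (0 < p)%N)
    (q_gt0 : (0 < q)%N) (r : R) (rE : r = p%:R / q%:R) (r_ge2 : 2 <= r) :
  asymp_equivalent R (closed_circle_graph r) (open_circle_graph r) <->
  (forall a b : nat -> nat,
    (forall n, (0 < a n)%N) -> (forall n, (0 < b n)%N) ->
    (forall n, (a n)%:R / (b n)%:R <= r) ->
    (a n)%:R / (b n)%:R @[n --> \oo] --> r ->
    spectrum_converges R (fun n => fraction_graph (a n) (b n))
      (fraction_graph p q)).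
Proof.
have r0 : 0 < r by apply: lt_le_trans r_ge2.
have qp : (2 * q <= p)%N.
  by move: r_ge2; rewrite rE ler_pdivlMr ?ltr0n // -natrM ler_nat.
split=> [[_ le_oc]|conv].
  exact: (asymp_le_fraction_converges q_gt0 qp rE le_oc).
split; last exact: (fraction_converges_asymp_le q_gt0 qp rE conv).
exists (fun=> 0%N); split.
  apply/eqoP => e e0; apply: nearW => n; rewrite normr0.
  by apply: mulr_ge0; [exact: ltW|exact: normr_ge0].
by move=> n; rewrite addn0; apply: cohom_le_power; exact: closed_le_open_circle.
Qed.
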